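(* Let $E$ be a finite-dimensional vector space over a field and let $\mathcal{D}\subseteq\mathcal{L}(E)$ satisfy: (D1) $\{0\}\notin\mathcal{D}$; (D2) if $D_1\in\mathcal{D}$ and $D_1\subseteq D_2$ then $D_2\in\mathcal{D}$; (D3) for all $D_1,D_2\in\mathcal{D}$ with $D_1\cap D_2\notin\mathcal{D}$, every subspace of codimension $1$ in $D_1+D_2$ belongs to $\mathcal{D}$. Then $\mathcal{I}:=\mathcal{L}(E)\setminus\mathcal{D}$ satisfies the independence axioms (I1)–(I4).
   Context: $\mathcal{L}(E)$ is the lattice of subspaces of $E$. Independence axioms: (I1) $\mathcal{I}\ne\emptyset$; (I2) if $J\in\mathcal{I}$ and $I\subseteq J$ then $I\in\mathcal{I}$; (I3) for $I,J\in\mathcal{I}$ with $\dim I<\dim J$ there is a $1$-dimensional $x\subseteq J$, $x\not\subseteq I$, with $I+x\in\mathcal{I}$; (I4) for all subspaces $A,B$ and all inclusion-maximal members $I$ of $\mathcal{I}$ contained in $A$ and $J$ of $\mathcal{I}$ contained in $B$, there is an inclusion-maximal member $K$ of $\mathcal{I}$ contained in $A+B$ with $K\subseteq I+J$. *)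

(* Defs.v *)
From mathcomp Require Import all_boot all_order all_algebra.
From mathcomp Require Import boolp classical_sets.

Set Implicit Arguments.
Unset Strict Implicit.
Unset Printing Implicit Defensive.

(* Subspaces of E are {vspace E}; a family of subspaces is an arbitrary
   (Prop-valued) set of them, not assumed decidable. *)

Section SubspaceFamilies.
Local Open Scope classical_set_scope.
Local Open Scope vspace_scope.
Variables (F : fieldType) (E : vectType F).
Implicit Types (A H K M N x : {vspace E}) (D I : set {vspace E}).

Record dependence_axioms D : Prop := DependenceAxioms {
  dep_D1 : ~ D 0%VS;
  dep_D2 : forall D1 D2 : {vspace E}, D D1 -> (D1 <= D2)%VS -> D D2;
  dep_D3 : forall D1 D2 : {vspace E}, D D1 -> D D2 -> ~ D (D1 :&: D2)%VS ->
    forall H, (H <= D1 + D2)%VS -> (\dim H).+1 = \dim (D1 + D2)%VS -> D H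
}.

Definition maximal_member_in I A M : Prop :=
  [/\ I M, (M <= A)%VS
    & forall N, I N -> (N <= A)%VS -> (M <= N)%VS -> N = M].

Record independence_axioms I : Prop := IndependenceAxioms {
  indep_I1 : I !=set0;
  indep_I2 : forall I1 J1 : {vspace E}, I J1 -> (I1 <= J1)%VS -> I I1;
  indep_I3 : forall I1 J1 : {vspace E}, I I1 -> I J1 -> (\dim I1 < \dim J1)%N ->
    exists x : {vspace E}, [/\ \dim x = 1%N, (x <= J1)%VS, ~~ (x <= I1)%VS
                & I (I1 + x)%VS];
  indep_I4 : forall A B I1 J1 : {vspace E},
    maximal_member_in I A I1 -> maximal_member_in I B J1 ->
    exists K, maximal_member_in I (A + B)%VS K /\ (K <= I1 + J1)%VS
}.

End SubspaceFamilies.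

(* Main.v *)
(** The closure of an independent [K], that is the set of vectors [v] in [K] or
    with [K + <[v]>] dependent, is closed under addition by (D3). The maximal
    independent subspaces of a given [A] are equidimensional, by exchange: given
    such an [I], an independent [S <= A] and [x] in [S] outside [I], any maximal
    independent subspace of [I + <[x]>] above [(I + <[x]>) :&: S] has the
    dimension of [I], is again maximal in [A], and meets [S] in a larger space.
    For (I4), any maximal independent [K] and [L] of [I + J] above [I] and [J]
    have the same closure, because they have the same dimension; it contains
    [A] thanks to [I] and [B] thanks to [J], hence [A + B]. *)
Require Import Defs.
From mathcomp Require Import all_boot all_order all_algebra.
From mathcomp Require Import boolp classical_sets.
From mathcomp Require Import zify.

Import GRing.Theory.

Local Open Scope classical_set_scope.

Section Subspaces.
Set Implicit Arguments.
Unset Strict Implicit.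
Local Open Scope vspace_scope.
Context {F : fieldType} {E : vectType F}.
Implicit Types (U V T : {vspace E}) (I : set {vspace E}) (v : E).

Lemma dimv_add_line U v : v \notin U -> \dim (U + <[v]>) = (\dim U).+1.
Proof.
move=> vU; have v0 : v != 0%R by apply: contraNneq vU => ->; rewrite mem0v.
have dI : U :&: <[v]> = 0.
  apply/eqP; rewrite -subv0; apply/subvP => w; rewrite memv_cap.
  case/andP => wU /vlineP[k wE]; rewrite memv0.
  have [k0|k0] := eqVneq k 0%R; first by rewrite wE k0 scale0r.
  by move: wU; rewrite wE rpredZeq (negbTE k0) (negbTE vU).
by rewrite dimv_disjoint_sum // dim_vline v0 addn1.
Qed.

Lemma dim_ltv_notin U V : (\dim V < \dim U)%N -> exists2 v, v \in U & v \notin V.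
Proof.
move=> lt; apply/subvPn; apply: contraL lt => /dimvS le.
by rewrite -leqNgt.
Qed.

Lemma add_line_sub U V v : (U <= V) -> v \in V -> (U + <[v]> <= V).
Proof. by move=> UV vV; rewrite subv_add UV -memvE. Qed.

Lemma mem_add_line U v : v \in U + <[v]>.
Proof. by rewrite memvE addvSr. Qed.

Lemma maximal_member_above I T U : I T -> (T <= U) ->
  exists2 M, (T <= M) & maximal_member_in I U M.
Proof.
have [n] := ubnP (\dim U - \dim T)%N; elim: n T => // n IHn T ltn IT TU.
have [maxT|] := pselect (maximal_member_in I U T); first by exists T.
move=> nmax; have [N [IN NU TN NT]] :
    exists N, [/\ I N, N <= U, T <= N & N <> T].
  apply: contrapT => nN; apply: nmax; split=> // N IN NU TN.
  by apply: contrapT => NT; apply: nN; exists N.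
have ltTN : (\dim T < \dim N)%N.
  rewrite ltn_neqAle dimvS // andbT; apply/eqP => dTN; apply: NT.
  by apply/esym/eqP; rewrite -(geq_leqif (dimv_leqif_eq TN)) dTN.
have [|//|M NM maxM] := IHn N _ IN; first by have := dimvS NU; lia.
by exists M => //; apply: subv_trans TN NM.
Qed.

End Subspaces.

Section Dependence.
Set Implicit Arguments.
Unset Strict Implicit.
Local Open Scope vspace_scope.
Context {F : fieldType} {E : vectType F} {D : set {vspace E}}.
Hypothesis axD : dependence_axioms D.
Implicit Types (A B H I J K S T U X Y : {vspace E}) (a b v x : E).

(** [X] lies in the closure of [K]. This is stated vector by vector because the closure is not known
    in advance to be a subspace. *)
Definition spans K X := forall v, v \in X -> v \notin K -> D (K + <[v]>).

Lemma maximal_spans K X : maximal_member_in (~` D) X K -> spans K X.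
Proof.
move=> [_ KX maxK] v vX; apply: contraNP => nD.
by rewrite -(maxK _ nD) ?addvSl ?mem_add_line // add_line_sub.
Qed.

Lemma spans_maximal K X :
  ~ D K -> (K <= X) -> spans K X -> maximal_member_in (~` D) X K.
Proof.
move=> nK KX spK; split=> // N nN NX KN; apply/eqP; rewrite eqEsubv KN andbT.
apply: contra_notT nN => /subvPn[v vN vK].
apply: (dep_D2 axD) (spK v _ vK) _; first exact: subvP vN.
exact: add_line_sub.
Qed.

(** Modulo [I], the vectors [a] and [b] span a plane, so [I + <[a]>] and [I + <[b]>] meet exactly in
    the independent space [I]. If [H] is the whole sum, (D2) applies; otherwise [H] has codimension
    1 in it and (D3) applies. *)
Lemma dependent_in_plane I H a b :
    ~ D I -> D (I + <[a]>) -> D (I + <[b]>) ->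
    a \notin I -> b \notin I + <[a]> ->
  (H <= I + <[a]> + <[b]>) -> (\dim I < \dim H)%N -> D H.
Proof.
move=> nI Da Db aI bIa HW ltIH.
have bI : b \notin I by apply: contra bIa; apply: subvP; apply: addvSl.
have dW : \dim (I + <[a]> + <[b]>) = (\dim I).+2 by rewrite !dimv_add_line.
have WE : (I + <[a]>) + (I + <[b]>) = I + <[a]> + <[b]>.
  by rewrite addvA -[in LHS](addvA I) (addvC <[a]>) addvA addvv.
have capE : (I + <[a]>) :&: (I + <[b]>) = I.
  apply/esym/eqP; rewrite -(geq_leqif (dimv_leqif_eq _)).
    have := dimv_sum_cap (I + <[a]>) (I + <[b]>).
    by rewrite WE dW !dimv_add_line //; lia.
  by rewrite subv_cap !addvSl.
have := dimvS HW; rewrite dW leq_eqVlt => /orP[/eqP dH|dH].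
  apply: (dep_D2 axD) Da _; suff -> : H = I + <[a]> + <[b]> by apply: addvSl.
  by apply/eqP; rewrite -(geq_leqif (dimv_leqif_eq HW)) dW dH.
apply: (dep_D3 axD) Da Db _ _ _ _; rewrite ?capE ?WE ?dW //; lia.
Qed.

Lemma spansD K X Y : ~ D K -> spans K X -> spans K Y -> spans K (X + Y).
Proof.
move=> nK spX spY v /memv_addP[x xX [y yY ->]] xyK.
have [xK|xK] := boolP (x \in K).
  have yK : y \notin K by apply: contra xyK; apply: memvD.
  apply: (dep_D2 axD) (spY y yY yK) _; rewrite add_line_sub ?addvSl //.
  rewrite -{1}[y](addKr x) memvD ?mem_add_line ?memvN //.
  by apply: subvP xK; apply: addvSl.
(* If [x] and [y] are proportional modulo [K], both [x] and [x + y] generate the same space over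
   [K]; otherwise [K + <[x + y]>] is a line in the plane case of (D3). *)
have [yKx|yKx] := boolP (y \in K + <[x]>).
  have xyKx : (K + <[(x + y)%R]> <= K + <[x]>).
    by rewrite add_line_sub ?addvSl // memvD ?mem_add_line.
  suff -> : K + <[(x + y)%R]> = K + <[x]> by apply: spX.
  by apply/eqP; rewrite -(geq_leqif (dimv_leqif_eq xyKx)) !dimv_add_line.
apply: (@dependent_in_plane K _ x y) => //; first exact: spX.
- apply: spY => //; apply: contra yKx; apply: subvP; exact: addvSl.
- rewrite add_line_sub //; first by rewrite -addvA addvSl.
  rewrite memvD ?mem_add_line //; apply: subvP (mem_add_line K x).
  exact: addvSl.
- by rewrite dimv_add_line.
Qed.

(** If [T] were smaller than [I], it would have codimension at least 2 in [U], leaving room for a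
    plane over [T]. The hyperplane [I] of [U] meets that space in dimension at least [\dim T + 1],
    hence in a dependent space. *)
Lemma maximal_codim_le1 I T U :
    ~ D I -> (I <= U) -> \dim U = (\dim I).+1 ->
  maximal_member_in (~` D) U T -> (\dim I <= \dim T)%N.
Proof.
move=> nI IU dU maxT; have spT := maximal_spans maxT.
have [nT TU _] := maxT; rewrite leqNgt; apply/negP => ltTI.
have [a aU aT] : exists2 a, a \in U & a \notin T by apply: dim_ltv_notin; lia.
have [b bU bTa] : exists2 b, b \in U & b \notin T + <[a]>.
  by apply: dim_ltv_notin; rewrite dimv_add_line //; lia.
have WU : (T + <[a]> + <[b]> <= U) by rewrite !add_line_sub.
have bT : b \notin T by apply: contra bTa; apply: subvP; apply: addvSl.
suff DI : D (I :&: (T + <[a]> + <[b]>)).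
  by apply: nI; apply: (dep_D2 axD) DI (capvSl _ _).
apply: (dependent_in_plane nT (spT _ aU aT) (spT _ bU bT)) => //.
  exact: capvSr.
have := dimv_sum_cap I (T + <[a]> + <[b]>).
have : (\dim (I + (T + <[a]> + <[b]>)) <= \dim U)%N.
  by rewrite dimvS // subv_add IU.
by rewrite !dimv_add_line //; lia.
Qed.

Lemma exchange A I S : maximal_member_in (~` D) A I -> ~ D S -> (S <= A) ->
    (\dim I < \dim S)%N ->
  exists I', [/\ maximal_member_in (~` D) A I', \dim I' = \dim I
                & (\dim (I :&: S) < \dim (I' :&: S))%N].
Proof.
move=> maxI nS SA ltIS; have spI := maximal_spans maxI.
have [nI IA _] := maxI; have [x xS xI] := dim_ltv_notin ltIS.
have xA := subvP SA x xS; set U := I + <[x]>.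
have nT : ~ D (U :&: S).
  by move=> DT; apply: nS; apply: (dep_D2 axD) DT (capvSr _ _).
have [T leT maxT] := maximal_member_above (I := ~` D) nT (capvSl U S).
have [nDT TU _] := maxT; have DU : D U by apply: spI.
have dU : \dim U = (\dim I).+1 by rewrite dimv_add_line.
have UA : (U <= A) by apply: add_line_sub.
(* [T] cannot be all of [U], since [U] is dependent. *)
have dT : \dim T = \dim I.
  apply/eqP; rewrite eqn_leq (maximal_codim_le1 nI (addvSl _ _) dU maxT) andbT.
  rewrite -ltnS -dU ltn_neqAle dimvS // andbT; apply: contra_not_neq nDT => dTU.
  suff -> : T = U by [].
  by apply/eqP; rewrite -(geq_leqif (dimv_leqif_eq TU)) dTU.
exists T; split=> //.
  apply: spans_maximal => //; first exact: subv_trans TU UA.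
  move=> y yA yT; have [yU|yU] := boolP (y \in U).
    exact: maximal_spans maxT y yU yT.
  (* [T + <[y]>] lies in [I + <[x]> + <[y]>] and is larger than [I], so the plane argument over [I]
     applies. *)
  have yI : y \notin I by apply: contra yU; apply: subvP; apply: addvSl.
  apply: dependent_in_plane nI DU (spI y yA yI) xI yU _ _.
    by rewrite addvS.
  by rewrite dimv_add_line ?dT.
(* [T :&: S] contains both [I :&: S] and the new vector [x]. *)
have xIS : x \notin I :&: S by rewrite memv_cap negb_and xI.
rewrite -(dimv_add_line xIS); apply: dimvS.
rewrite subv_cap [X in _ && X]add_line_sub ?capvSr // andbT.
apply: subv_trans leT; rewrite subv_cap.
by rewrite addvS ?capvSl // add_line_sub ?capvSr.
Qed.

(** Each exchange keeps the dimension of [I] but enlarges [I :&: S], which cannot grow beyond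
    [S]. *)
Lemma dim_le_maximal A I S :
  maximal_member_in (~` D) A I -> ~ D S -> (S <= A) -> (\dim S <= \dim I)%N.
Proof.
move=> maxI nS SA; have [n] := ubnP (\dim S - \dim (I :&: S))%N.
elim: n I maxI => // n IHn I maxI ltn; rewrite leqNgt; apply/negP => ltIS.
have [I' [maxI' dI' ltI']] := exchange maxI nS SA ltIS.
have leI'S := dimvS (capvSr I' S).
by have /(IHn I' maxI') : (\dim S - \dim (I' :&: S) < n)%N; lia.
Qed.

Lemma dim_ge_maximal A I K : maximal_member_in (~` D) A I ->
  ~ D K -> (K <= A) -> (\dim I <= \dim K)%N -> maximal_member_in (~` D) A K.
Proof.
move=> maxI nK KA leIK; split=> // N nN NA KN; apply/esym/eqP.
rewrite -(geq_leqif (dimv_leqif_eq KN)); apply: leq_trans leIK.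
exact: dim_le_maximal maxI nN NA.
Qed.

Lemma independent_augment I J : ~ D I -> ~ D J -> (\dim I < \dim J)%N ->
  exists x : {vspace E}, [/\ \dim x = 1%N, (x <= J)%VS, ~~ (x <= I)%VS
                          & ~ D (I + x)].
Proof.
move=> nI nJ ltIJ; apply: contrapT => nx.
(* If no line of [J] augments [I], then [I] is maximal in [I + J], and the independent [J] is too
   large. *)
suff spIJ : spans I (I + J).
  have := dim_le_maximal (spans_maximal nI (addvSl _ _) spIJ) nJ (addvSr _ _).
  lia.
apply: spansD => // [v vI|v vJ vI]; first by rewrite vI.
apply: contrapT => nIv; apply: nx; exists <[v]>; split=> //.
  by rewrite dim_vline; case: eqP vI => // ->; rewrite mem0v.
Qed.

Lemma maximal_in_sum A B I J :
    maximal_member_in (~` D) A I -> maximal_member_in (~` D) B J ->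
  exists K, maximal_member_in (~` D) (A + B) K /\ (K <= I + J).
Proof.
move=> maxI maxJ; have [nI IA _] := maxI; have [nJ JB _] := maxJ.
have spans_above K K' X : (K <= K') -> spans K X -> spans K' X.
  move=> KK' spK v vX vK'; apply: (dep_D2 axD) (addvS KK' (subvv _)).
  by apply: spK => //; apply: contra vK'; apply: subvP.
have [K IK maxK] := maximal_member_above (I := ~` D) nI (addvSl I J).
have [L JL maxL] := maximal_member_above (I := ~` D) nJ (addvSr I J).
have [nK KIJ _] := maxK; have [nL LIJ _] := maxL.
exists K; split=> //; set U := I + J.
(* The closure of [L] contains [U] by maximality and [B] because it contains the closure of [J]. *)
have maxLB : maximal_member_in (~` D) (U + B) L.
  apply: spans_maximal => //; first exact: subv_trans LIJ (addvSl _ _).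
  apply: spansD => //; first exact: maximal_spans.
  exact: spans_above JL (maximal_spans maxJ).
(* [K] is at least as large as [L], so maximality in [U + B] passes to [K]; this is how [K] comes to
   span [B]. *)
have maxKB : maximal_member_in (~` D) (U + B) K.
  apply: dim_ge_maximal maxLB nK _ _; first exact: subv_trans KIJ (addvSl _ _).
  exact: dim_le_maximal maxK nL LIJ.
apply: spans_maximal => //; first exact: subv_trans KIJ (addvS IA JB).
apply: spansD => //; first exact: spans_above IK (maximal_spans maxI).
by move=> v vB; apply: (maximal_spans maxKB); apply: subvP vB; apply: addvSr.
Qed.

End Dependence.

Theorem theorem68 (F : fieldType) (E : vectType F) (D : set {vspace E}) :
  dependence_axioms D -> independence_axioms (~` D).
Proof.
move=> axD; split.
- by exists 0%VS; apply: dep_D1 axD.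
- by move=> I J nJ IJ DI; apply: nJ; apply: (dep_D2 axD) DI IJ.
- by move=> I J; apply: independent_augment.
- by move=> A B I J; apply: maximal_in_sum.
Qed.
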